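(* Let $U$ be the Koopman operator on $L_2(\nu)$ of an invertible measure-preserving transformation $T$, with spectral resolution $U=\int_{[0,1]}e^{i2\pi\theta}\,dE(\theta)$. For each $K\in\mathbb{N}$ let $(A_{j,K})_{j=1}^K$ be a disjoint partition of $[0,1]$ into Borel sets (i.e. $A_{j,K}\cap A_{l,K}=\emptyset$ if $j\neq l$ and $\bigcup_{j=1}^K A_{j,K}=[0,1]$) such that $$\lim_{K\to\infty}\max_{j=1,\ldots,K}\mathrm{diam}(A_{j,K})=0,$$ and let $\theta_{j,K}\in A_{j,K}$. Then the operators $$U_K=\sum_{j=1}^{K}e^{i2\pi\theta_{j,K}}E(A_{j,K})$$ converge to $U$ in the strong operator topology, i.e. $$\lim_{K\to\infty}\|U_Kf-Uf\|_{L_2(\nu)}=0$$ for all $f\in L_2(\nu)$.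
   Context: Setting: $(\mathcal{X},\mathfrak{M},\nu)$ is a measure space and $T:\mathcal{X}\to\mathcal{X}$ is an invertible measure-preserving transformation: a measurable bijection with measurable inverse such that $\nu(T^{-1}(A))=\nu(A)$ for all $A\in\mathfrak{M}$. The Koopman operator $U:L_2(\nu)\to L_2(\nu)$, $Uf=f\circ T$, acts on complex-valued square-integrable functions and is unitary. By the spectral theorem $U$ has a spectral measure on the unit circle; it is regarded, via $\theta\mapsto e^{i2\pi\theta}$, as a projection-valued measure $E$ on the Borel subsets of $[0,1]$ (values in the orthogonal projections on $L_2(\nu)$, with $E([0,1])=I$) satisfying $U=\int_{[0,1]}e^{i2\pi\theta}\,dE(\theta)$. For $A\subset[0,1]$, $\mathrm{diam}(A)=\sup(A)-\inf(A)$. *)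

(* Defs.v *)
From HB Require Import structures.
From mathcomp Require Import all_boot all_order all_algebra.
From mathcomp Require Import all_classical all_reals all_analysis measurable_realfun.
From mathcomp Require Import complex ring lra.

Set Implicit Arguments.
Unset Strict Implicit.
Unset Printing Implicit Defensive.

Import Order.TTheory GRing.Theory Num.Theory.
Import ComplexField.Normc.
Import numFieldNormedType.Exports.

(* [Re] and [Im] would otherwise be the algC-style ['Re] and ['Im], which take
   their values in R[i] instead of R. *)
Local Notation Re := complex.Re.
Local Notation Im := complex.Im.

Local Open Scope classical_set_scope.
Local Open Scope ring_scope.
Local Open Scope complex_scope.

Section complex_integral.
Context d (X : measurableType d) (R : realType).

Definition cmeasurable (f : X -> R[i]) : Prop :=
  measurable_fun setT (fun x => Re (f x)) /\
  measurable_fun setT (fun x => Im (f x)).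

Definition cintegral (mu : {measure set X -> \bar R}) (D : set X)
    (f : X -> R[i]) : R[i] :=
  (\int[mu]_(x in D) Re (f x)) +i* (\int[mu]_(x in D) Im (f x)).

Definition square_integrable (mu : {measure set X -> \bar R})
    (f : X -> R[i]) : Prop :=
  cmeasurable f /\ (\int[mu]_x ((normc (f x) ^+ 2)%:E) < +oo)%E.

End complex_integral.

Section complex_lemmas.
Context (R : realType).
Implicit Types z w : R[i].

Lemma sqr_normcE z : normc z ^+ 2 = Re z ^+ 2 + Im z ^+ 2.
Proof. by case: z => a b /=; rewrite sqr_sqrtr// addr_ge0// sqr_ge0. Qed.

Lemma ReD z w : Re (z + w) = Re z + Re w. Proof. by case: z; case: w. Qed.
Lemma ImD z w : Im (z + w) = Im z + Im w. Proof. by case: z; case: w. Qed.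
Lemma ReN z : Re (- z) = - Re z. Proof. by case: z. Qed.
Lemma ImN z : Im (- z) = - Im z. Proof. by case: z. Qed.
Lemma ReM z w : Re (z * w) = Re z * Re w - Im z * Im w.
Proof. by case: z; case: w. Qed.
Lemma ImM z w : Im (z * w) = Re z * Im w + Im z * Re w.
Proof. by case: z; case: w. Qed.
Lemma Re_conjc z : Re (z^*) = Re z. Proof. by case: z. Qed.
Lemma Im_conjc z : Im (z^*) = - Im z. Proof. by case: z. Qed.

End complex_lemmas.

Section L2fun.
Context d (X : measurableType d) (R : realType).
Variable nu : {measure set X -> \bar R}.
Implicit Types f g : X -> R[i].

Definition sqint_pred : {pred X -> R[i]} :=
  fun f => `[< square_integrable nu f >].

Lemma measurable_sqr_normc f : cmeasurable f ->
  measurable_fun setT (fun x => normc (f x) ^+ 2).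
Proof.
move=> [mr mi].
under eq_fun do rewrite sqr_normcE.
by apply: measurable_funD; apply: measurable_funX.
Qed.

Lemma sqr_normc_integrable f : square_integrable nu f ->
  nu.-integrable setT (EFin \o (fun x => normc (f x) ^+ 2)).
Proof.
move=> [mf iff]; apply/integrableP; split.
  exact/measurable_EFinP/measurable_sqr_normc.
by under eq_integral do rewrite /= ger0_norm ?sqr_ge0//.
Qed.

Lemma sqint_submod_closed : submod_closed sqint_pred.
Proof.
split.
  apply/asboolP; split; first by split; exact: measurable_cst.
  rewrite (eq_integral (cst 0%E)) ?integral0// => x _ /=.
  by rewrite expr0n/= addr0 sqrtr0 expr0n.
move=> a f g /asboolP hf /asboolP hg; apply/asboolP.
have [[mrf mif] _] := hf; have [[mrg mig] _] := hg.
have mfg : cmeasurable (a *: f + g).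
  split.
  - rewrite (_ : (fun x => _) = (fun x => (Re a * Re (f x) - Im a * Im (f x))
        + Re (g x))).
      apply: measurable_funD => //; apply: measurable_funB;
      by apply: measurable_funM.
    by apply/funext => x; rewrite -ReM -ReD.
  - rewrite (_ : (fun x => _) = (fun x => (Re a * Im (f x) + Im a * Re (f x))
        + Im (g x))).
      apply: measurable_funD => //; apply: measurable_funD;
      by apply: measurable_funM.
    by apply/funext => x; rewrite -ImM -ImD.
split=> //.
have hI : nu.-integrable setT (fun x =>
    ((2 * normc a ^+ 2)%:E * (normc (f x) ^+ 2)%:E +
     2%:E * (normc (g x) ^+ 2)%:E)%E).
  apply: integrableD => //; apply: integrableZl => //;
  exact: sqr_normc_integrable.
have mE : measurable_fun setT (EFin \o (fun x => normc ((a *: f + g) x) ^+ 2)).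
  exact/measurable_EFinP/measurable_sqr_normc.
have /integrableP[_] : nu.-integrable setT
    (EFin \o (fun x => normc ((a *: f + g) x) ^+ 2)).
  apply: (le_integrable _ mE _ hI) => // x _ /=.
  rewrite lee_fin (ger0_norm (sqr_ge0 _)) ger0_norm; last first.
    by apply: addr_ge0; do ?[exact: sqr_ge0|exact: ler0n|apply: mulr_ge0].
  rewrite !sqr_normcE [(a *: f + g) x]/(a * f x + g x) ReD ImD ReM ImM.
  move: (Re a) (Im a) (Re (f x)) (Im (f x)) (Re (g x)) (Im (g x)).
  move=> p q r s t u.
  have := sqr_ge0 (p * r - q * s - t); have := sqr_ge0 (p * s + q * r - u).
  nra.
by under eq_integral do rewrite /= ger0_norm ?sqr_ge0//.
Qed.

HB.instance Definition _ :=
  GRing.isSubmodClosed.Build _ _ sqint_pred sqint_submod_closed.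

Record L2fun := MkL2fun {
  L2fun_val :> X -> R[i] ;
  L2fun_subproof : L2fun_val \in sqint_pred }.

HB.instance Definition _ := [isSub for L2fun_val].
HB.instance Definition _ := [Choice of L2fun by <:].
HB.instance Definition _ := [SubChoice_isSubLmodule of L2fun by <:].

End L2fun.

Section L2.
Context d (X : measurableType d) (R : realType).
Variable nu : {measure set X -> \bar R}.
Notation L2fun := (L2fun nu).

Definition L2_eq_op (f g : L2fun) : bool :=
  `[< (f : X -> R[i]) = g %[ae nu] >].

Let L2_eq_refl : reflexive L2_eq_op.
Proof. by move=> f; apply/asboolP/aeW. Qed.

Let L2_eq_sym : symmetric L2_eq_op.
Proof.
by move=> f g; apply/idP/idP => /asboolP h; apply/asboolP;
  apply: filterS h => x h /h.
Qed.

Let L2_eq_trans : transitive L2_eq_op.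
Proof.
move=> g f h /asboolP fg /asboolP gh; apply/asboolP.
by apply: filterS2 fg gh => x e1 e2 I; rewrite e1// e2.
Qed.

Canonical L2_eq_equiv := EquivRel L2_eq_op L2_eq_refl L2_eq_sym L2_eq_trans.

Local Open Scope quotient_scope.

(* Complex-valued square-integrable functions modulo equality nu-almost
   everywhere; no finiteness of nu is assumed. *)
Definition L2 : Type := {eq_quot L2_eq_op}.
HB.instance Definition _ := Choice.on L2.
HB.instance Definition _ := EqQuotient.on L2.

Definition L2_class (f : L2fun) : L2 := \pi_L2 f.
Definition L2_repr (u : L2) : L2fun := repr u.

Lemma L2_classK : cancel L2_repr L2_class.
Proof. exact: reprK. Qed.

Lemma L2_class_eq (f g : L2fun) :
  (f : X -> R[i]) = g %[ae nu] -> L2_class f = L2_class g.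
Proof. by move=> fg; apply/eqP; rewrite eqmodE; apply/asboolP. Qed.

Lemma L2_repr_class (f : L2fun) : (L2_repr (L2_class f) : X -> R[i]) = f %[ae nu].
Proof.
have := L2_classK (L2_class f); rewrite /L2_class => /eqP.
by rewrite eqmodE => /asboolP.
Qed.

Definition L2_add (u v : L2) : L2 := L2_class (L2_repr u + L2_repr v).
Definition L2_opp (u : L2) : L2 := L2_class (- L2_repr u).
Definition L2_scale (a : R[i]) (u : L2) : L2 := L2_class (a *: L2_repr u).

Lemma L2_class_add f g : L2_add (L2_class f) (L2_class g) = L2_class (f + g).
Proof.
apply: L2_class_eq; apply: filterS2 (L2_repr_class f) (L2_repr_class g).
by move=> x e1 e2 I; rewrite /= [LHS]/(_ + _) e1// e2.
Qed.

Lemma L2_class_opp f : L2_opp (L2_class f) = L2_class (- f).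
Proof.
apply: L2_class_eq; apply: filterS (L2_repr_class f).
by move=> x e1 I; rewrite /= [LHS]/(- _) e1.
Qed.

Lemma L2_class_scale a f : L2_scale a (L2_class f) = L2_class (a *: f).
Proof.
apply: L2_class_eq; apply: filterS (L2_repr_class f).
by move=> x e1 I; rewrite /= [LHS]/(a * _) e1.
Qed.

Let L2_ind (P : L2 -> Prop) : (forall f, P (L2_class f)) -> forall u, P u.
Proof. by move=> h u; rewrite -(L2_classK u). Qed.

Let addA : associative L2_add.
Proof.
elim/L2_ind => f; elim/L2_ind => g; elim/L2_ind => h.
by rewrite !L2_class_add addrA.
Qed.
Let addC : commutative L2_add.
Proof. by elim/L2_ind => f; elim/L2_ind => g; rewrite !L2_class_add addrC. Qed.
Let add0 : left_id (L2_class 0) L2_add.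
Proof. by elim/L2_ind => f; rewrite L2_class_add add0r. Qed.
Let addN : left_inverse (L2_class 0) L2_opp L2_add.
Proof. by elim/L2_ind => f; rewrite L2_class_opp L2_class_add addNr. Qed.

HB.instance Definition _ := GRing.isZmodule.Build L2 addA addC add0 addN.

Lemma L2_classD f g : L2_class (f + g) = L2_class f + L2_class g.
Proof. by rewrite -L2_class_add. Qed.
Lemma L2_classN f : L2_class (- f) = - L2_class f.
Proof. by rewrite -L2_class_opp. Qed.

Let scaleA a b (u : L2) : L2_scale a (L2_scale b u) = L2_scale (a * b) u.
Proof. by elim/L2_ind: u => f; rewrite !L2_class_scale scalerA. Qed.
Let scale1 : left_id 1 L2_scale.
Proof. by elim/L2_ind => f; rewrite L2_class_scale scale1r. Qed.
Let scaleDr : right_distributive L2_scale +%R.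
Proof.
move=> a; elim/L2_ind => f; elim/L2_ind => g.
by rewrite -L2_classD !L2_class_scale scalerDr L2_classD.
Qed.
Let scaleDl u : {morph L2_scale^~ u : a b / a + b}.
Proof.
move=> a b; elim/L2_ind: u => f.
by rewrite !L2_class_scale scalerDl L2_classD.
Qed.

HB.instance Definition _ := GRing.Zmodule_isLmodule.Build R[i] L2
  scaleA scale1 scaleDr scaleDl.

Lemma L2_classZ a f : L2_class (a *: f) = a *: L2_class f.
Proof. by rewrite -L2_class_scale. Qed.

Definition L2_dot (u v : L2) : R[i] :=
  cintegral nu setT (fun x => L2_repr u x * (L2_repr v x)^*).

Definition L2_norm (u : L2) : R :=
  Num.sqrt (\int[nu]_x (normc (L2_repr u x) ^+ 2)).

End L2.

Section koopman.
Context d (X : measurableType d) (R : realType).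
Variable nu : {measure set X -> \bar R}.

Record invertible_mpt (T : X -> X) : Prop := InvertibleMpt {
  mpt_measurable : measurable_fun setT T ;
  mpt_inverse : exists2 S : X -> X,
    measurable_fun setT S & cancel T S /\ cancel S T ;
  mpt_preserving : forall A, measurable A -> nu (T @^-1` A) = nu A }.

Variables (T : X -> X) (hT : invertible_mpt T).

Lemma cmeasurable_comp (f : X -> R[i]) : cmeasurable f -> cmeasurable (f \o T).
Proof.
have mT := mpt_measurable hT.
by move=> [mr mi]; split; [exact: (measurableT_comp mr mT)|
  exact: (measurableT_comp mi mT)].
Qed.

Lemma ge0_integral_mpt (g : X -> \bar R) : measurable_fun setT g ->
  (forall x, 0 <= g x)%E -> (\int[nu]_x g (T x) = \int[nu]_x g x)%E.
Proof.
move=> mg g0; have mT := mpt_measurable hT.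
transitivity (\int[pushforward nu T]_x g x)%E.
  by rewrite ge0_integral_pushforward.
apply: eq_measure_integral => A mA _; rewrite /= /pushforward.
exact: (mpt_preserving hT).
Qed.

Lemma koopman_subproof (f : L2fun nu) : (f : X -> R[i]) \o T \in sqint_pred nu.
Proof.
have /asboolP[mf fi] := L2fun_subproof f.
apply/asboolP; split; first exact: cmeasurable_comp.
rewrite (ge0_integral_mpt (g := fun x => ((normc (f x) ^+ 2)%:E)))//.
  exact/measurable_EFinP/measurable_sqr_normc.
by move=> x; rewrite lee_fin sqr_ge0.
Qed.

Definition koopman (u : L2 nu) : L2 nu :=
  L2_class (MkL2fun (koopman_subproof (L2_repr u))).

Lemma koopmanE (f : L2fun nu) :
  koopman (L2_class f) = L2_class (MkL2fun (koopman_subproof f)).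
Proof.
apply: L2_class_eq; have [N [mN N0 sN]] := L2_repr_class f.
exists (T @^-1` N); split.
- by rewrite -[X in measurable X]setTI; exact: (mpt_measurable hT).
- by rewrite (mpt_preserving hT).
- by move=> x h; apply: sN => h'; apply: h => _; exact: h'.
Qed.

End koopman.

Section L2_inner_product.
Context d (X : measurableType d) (R : realType).
Variable nu : {measure set X -> \bar R}.
Implicit Types (f g : L2fun nu) (u v w : L2 nu).

Lemma L2fun_square_integrable f : square_integrable nu f.
Proof. by have /asboolP := L2fun_subproof f. Qed.

Lemma ReMJ_integrable f g :
  nu.-integrable setT (EFin \o (fun x => Re (f x * (g x)^*))).
Proof.
have hf := L2fun_square_integrable f; have hg := L2fun_square_integrable g.
have [[mrf mif] _] := hf; have [[mrg mig] _] := hg.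
have hI : nu.-integrable setT
    (fun x => ((normc (f x) ^+ 2)%:E + (normc (g x) ^+ 2)%:E)%E).
  by apply: integrableD => //; exact: sqr_normc_integrable.
apply: (le_integrable _ _ _ hI) => // [|x _ /=].
  apply/measurable_EFinP.
  rewrite (_ : (fun x => _) =
      (fun x => Re (f x) * Re (g x) + Im (f x) * Im (g x))).
    by apply: measurable_funD; apply: measurable_funM.
  by apply/funext => x; rewrite ReM Re_conjc Im_conjc; ring.
rewrite lee_fin [leRHS]ger0_norm; last first.
  by apply: addr_ge0; exact: sqr_ge0.
rewrite !sqr_normcE ReM Re_conjc Im_conjc ler_norml.
move: (Re (f x)) (Im (f x)) (Re (g x)) (Im (g x)) => r s t q.
have := sqr_ge0 (r + t); have := sqr_ge0 (r - t).
have := sqr_ge0 (s + q); have := sqr_ge0 (s - q).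
have := sqr_ge0 r; have := sqr_ge0 s; have := sqr_ge0 t; have := sqr_ge0 q.
by move=> *; apply/andP; split; nra.
Qed.

Definition ReMJ_int f g : R := \int[nu]_x Re (f x * (g x)^*).

Lemma ae_eq_Rintegral (f g : X -> R) :
  nu.-integrable setT (EFin \o f) -> nu.-integrable setT (EFin \o g) ->
  f = g %[ae nu] -> \int[nu]_x f x = \int[nu]_x g x.
Proof.
move=> /integrableP[mf _] /integrableP[mg _] fg; rewrite /Rintegral.
congr fine; apply: ae_eq_integral => //.
by apply: filterS fg => x h I /=; rewrite h.
Qed.

Lemma Re_L2_dot f g : Re (L2_dot (L2_class f) (L2_class g)) = ReMJ_int f g.
Proof.
apply: ae_eq_Rintegral; [exact: ReMJ_integrable..|].
apply: filterS2 (L2_repr_class f) (L2_repr_class g) => x e1 e2 I.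
by rewrite e1// e2.
Qed.

Lemma Re_L2_dotDl u v w :
  Re (L2_dot (u + v) w) = Re (L2_dot u w) + Re (L2_dot v w).
Proof.
rewrite -(L2_classK u) -(L2_classK v) -(L2_classK w).
move: (L2_repr _) (L2_repr _) (L2_repr _) => f g h.
rewrite -L2_classD !Re_L2_dot /ReMJ_int -RintegralD//;
  [|exact: ReMJ_integrable..].
by apply: eq_Rintegral => x _; rewrite -ReD -mulrDl.
Qed.

Lemma Re_L2_dotNl u v : Re (L2_dot (- u) v) = - Re (L2_dot u v).
Proof.
have : Re (L2_dot (- u + u + u) v) = Re (L2_dot u v) by rewrite addNr add0r.
by rewrite !Re_L2_dotDl; lra.
Qed.

Lemma Re_L2_dot_suml (F : nat -> L2 nu) v n :
  Re (L2_dot (\sum_(0 <= i < n) F i) v) = \sum_(0 <= i < n) Re (L2_dot (F i) v).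
Proof.
elim: n => [|n IHn]; last first.
  by rewrite big_nat_recr// [in RHS]big_nat_recr// Re_L2_dotDl IHn.
rewrite !big_nil; have := Re_L2_dotDl 0 0 v; rewrite addr0; lra.
Qed.

Lemma sqr_L2_norm u : L2_norm u ^+ 2 = Re (L2_dot u u).
Proof.
rewrite /L2_norm sqr_sqrtr; last by apply: Rintegral_ge0 => x _; exact: sqr_ge0.
apply: eq_Rintegral => x _.
by rewrite sqr_normcE ReM Re_conjc Im_conjc; ring.
Qed.

Lemma Re_L2_dot_ge0 u : 0 <= Re (L2_dot u u).
Proof. by rewrite -sqr_L2_norm sqr_ge0. Qed.

Lemma Re_L2_dot_le u v (t : R) : 0 < t ->
  `|Re (L2_dot u v)| <= t * L2_norm u ^+ 2 + t^-1 * L2_norm v ^+ 2.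
Proof.
move=> t0.
have sqrtn w : L2_norm w ^+ 2 = \int[nu]_x (normc (L2_repr w x) ^+ 2).
  rewrite /L2_norm sqr_sqrtr//.
  by apply: Rintegral_ge0 => x _; exact: sqr_ge0.
have sqint w : nu.-integrable setT
    (EFin \o (fun x => normc (L2_repr w x) ^+ 2)).
  exact/sqr_normc_integrable/L2fun_square_integrable.
have sqintZ a w : nu.-integrable setT
    (EFin \o (fun x => a * normc (L2_repr w x) ^+ 2)).
  rewrite (_ : EFin \o _ = (fun x => a%:E * (normc (L2_repr w x) ^+ 2)%:E)%E).
    exact: integrableZl (sqint w).
  by apply/funext => x /=; rewrite EFinM.
apply: le_trans; first by apply: le_normr_Rintegral => //; exact: ReMJ_integrable.
rewrite !sqrtn -!RintegralZl// -RintegralD//.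
apply: le_Rintegral => // [||x _].
- exact/integrable_norm/ReMJ_integrable.
- have := integrableD measurableT (sqintZ t u) (sqintZ t^-1 v).
  by apply: eq_integrable => // x _ /=; rewrite EFinD.
rewrite !sqr_normcE ReM Re_conjc Im_conjc ler_norml.
move: (Re (L2_repr u x)) (Im (L2_repr u x)) => p q.
move: (Re (L2_repr v x)) (Im (L2_repr v x)) => r s.
have tV : t * t^-1 = 1 by rewrite mulfV// gt_eqF.
have t'0 : 0 < t^-1 by rewrite invr_gt0.
set t' := t^-1 in tV t'0 *.
have h (a b : R) : 2 * a * b <= t * a ^+ 2 + t' * b ^+ 2.
  rewrite -subr_ge0 (_ : _ - _ = t' * (t * a - b) ^+ 2).
    by rewrite mulr_ge0// ?sqr_ge0// ltW.
  have -> : t * a ^+ 2 = (t * t') * t * a ^+ 2 by rewrite tV mul1r.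
  have -> : 2 * a * b = (t * t') * (2 * a * b) by rewrite tV mul1r.
  by ring.
have sq a b : 0 < a -> 0 <= a * b ^+ 2 :> R.
  by move=> a0; rewrite mulr_ge0// ?sqr_ge0// ltW.
have := h p r; have := h q s; have := h (- p) r; have := h (- q) s.
have := sq _ p t0; have := sq _ q t0; have := sq _ r t'0; have := sq _ s t'0.
rewrite !sqrrN => *; apply/andP; split; lra.
Qed.

Lemma Re_L2_dot_cvg (F : nat -> L2 nu) u v :
  L2_norm (F n - u) @[n --> \oo] --> (0 : R) ->
  Re (L2_dot (F n) v) @[n --> \oo] --> Re (L2_dot u v).
Proof.
move=> Fu; apply/cvgrPdist_le => e e0.
set V := L2_norm v ^+ 2.
have V0 : 0 <= V by exact: sqr_ge0.
pose t := 2 * (V + 1) / e.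
have t0 : 0 < t by rewrite /t; do ?apply: divr_gt0 => //; rewrite mulr_gt0// ltr_wpDl.
have c0 : 0 < e / 2 / t by apply: divr_gt0 => //; exact: divr_gt0.
have F2 : L2_norm (F n - u) ^+ 2 @[n --> \oo] --> (0 : R).
  have -> : 0 = 0 * 0 :> R by rewrite mulr0.
  under eq_fun do rewrite expr2.
  exact: cvgM.
move/cvgrPdist_le: F2 => /(_ _ c0); apply: filterS => n.
rewrite sub0r normrN ger0_norm ?sqr_ge0// => hn.
rewrite distrC -Re_L2_dotNl -Re_L2_dotDl.
apply: (le_trans (Re_L2_dot_le _ _ t0)).
have h1 : t * L2_norm (F n - u) ^+ 2 <= e / 2.
  by rewrite mulrC -ler_pdivlMr.
have h2 : t^-1 * V <= e / 2.
  rewrite /t invf_div mulrAC ler_pdivrMr ?mulr_gt0// ?ltr_wpDl//.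
  by have := mulr_ge0 (ltW e0) V0; nra.
by rewrite -/V; lra.
Qed.

End L2_inner_product.

Section projection_valued_measure.
Context d (X : measurableType d) (R : realType).
Variable nu : {measure set X -> \bar R}.

Record orthogonal_projection (P : L2 nu -> L2 nu) : Prop := {
  orthproj_linear : linear P ;
  orthproj_idem : forall u, P (P u) = P u ;
  orthproj_selfadj : forall u v, L2_dot (P u) v = L2_dot u (P v) }.

Definition unit_borel (A : set R) : Prop :=
  measurable A /\ A `<=` `[0, 1]%classic.

(* Only the values of [E] on the Borel subsets of [0, 1] are constrained;
   countable additivity is in the strong operator topology. *)
Record projection_valued_measure (E : set R -> L2 nu -> L2 nu) : Prop := {
  pvm_proj : forall A, unit_borel A -> orthogonal_projection (E A) ;
  pvm_set0 : forall u, E set0 u = 0 ;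
  pvm_full : forall u, E `[0, 1]%classic u = u ;
  pvm_setI : forall A B, unit_borel A -> unit_borel B ->
    forall u, E (A `&` B) u = E A (E B u) ;
  pvm_sigma_additive : forall F : nat -> set R,
    (forall n, unit_borel (F n)) -> trivIset setT F ->
    forall u, L2_norm (\sum_(0 <= i < n) E (F i) u - E (\bigcup_i F i) u)
      @[n --> \oo] --> (0 : R) }.

Variables (E : set R -> L2 nu -> L2 nu) (hE : projection_valued_measure E).

(* The scalar spectral measure A |-> <E(A) u, u>, extended by A |-> A `&` [0, 1]
   to a measure on the Borel sets of R.  The junk value on non-measurable sets
   is there because the measure structure asks for nonnegativity everywhere. *)
Definition spectral_measure of projection_valued_measure E :=
  fun (u : L2 nu) (A : set R) =>
  if `[< measurable A >] then (Re (L2_dot (E (A `&` `[0, 1]) u) u))%:E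
  else 0%E : \bar R.

Let capI_unit_borel (A : set R) : measurable A -> unit_borel (A `&` `[0, 1]).
Proof. by move=> mA; split; [exact: measurableI|exact: subIsetr]. Qed.

Let spectral_measure0 u : spectral_measure hE u set0 = 0%E.
Proof.
rewrite /spectral_measure ifT; last exact/asboolP.
rewrite set0I (pvm_set0 hE).
have h := Re_L2_dotDl (0 : L2 nu) 0 u; rewrite addr0 in h.
by congr EFin; lra.
Qed.

Let spectral_measure_ge0 u A : (0 <= spectral_measure hE u A)%E.
Proof.
rewrite /spectral_measure; case: ifPn => // /asboolP /capI_unit_borel uA.
have pA := pvm_proj hE uA; rewrite lee_fin.
by rewrite -(orthproj_idem pA) (orthproj_selfadj pA) Re_L2_dot_ge0.
Qed.

Let spectral_measure_sigma_additive u : semi_sigma_additive (spectral_measure hE u).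
Proof.
move=> F mF tF mUF.
rewrite [X in _ --> X]/spectral_measure ifT; last exact/asboolP.
rewrite setI_bigcupl.
have tG : trivIset setT (fun i => F i `&` `[0, 1]%classic).
  apply/trivIsetP => i j _ _ ij; rewrite setIACA setIid.
  by move/trivIsetP : tF => ->//; rewrite set0I.
have := pvm_sigma_additive hE (fun i => capI_unit_borel (mF i)) tG u.
move=> /(Re_L2_dot_cvg (v := u)) h.
rewrite (_ : (fun n => _) = EFin \o (fun n =>
    Re (L2_dot (\sum_(0 <= i < n) E (F i `&` `[0, 1]) u) u))).
  by apply: cvg_EFin => //; exact: nearW.
apply/funext => n; rewrite -[RHS]/((Re (L2_dot _ u))%:E) Re_L2_dot_suml -sumEFin.
apply: eq_bigr => i _; rewrite /spectral_measure ifT//; exact/asboolP.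
Qed.

HB.instance Definition _ u := isMeasure.Build _ _ _ (spectral_measure hE u)
  (spectral_measure0 u) (spectral_measure_ge0 u)
  (@spectral_measure_sigma_additive u).

(* S = \int_[0, 1] phi dE, in the weak sense: <S u, u> is the integral of phi
   against the spectral measure of u.  Since the scalars are complex, these
   diagonal values determine a linear S by polarization. *)
Definition is_spectral_integral (phi : R -> R[i]) (S : L2 nu -> L2 nu) : Prop :=
  forall u, L2_dot (S u) u = cintegral (spectral_measure hE u) `[0, 1] phi.

End projection_valued_measure.

Definition expi2pi (R : realType) (theta : R) : R[i] :=
  cos (2 * pi * theta) +i* sin (2 * pi * theta).

Definition diam (R : realType) (A : set R) : R := sup A - inf A.

(* Main.v *)
(** Convergence even holds in operator norm. Let e be 2 pi times the mesh of the
    partition and D := U_K - U. Since theta |-> exp(2 pi i theta) has 2 pi-Lipschitz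
    real and imaginary parts, comparing a tagged Riemann sum with the integral
    against the spectral measure of u, whose mass is |u|^2, bounds the real and
    imaginary parts of <D u, u> by e |u|^2. Polarization turns this bound on the
    quadratic form into |D u| <= 2 e |u|. Hence the diagonal values of U, which
    are all that the weak spectral integral prescribes, suffice. *)

Require Import Defs.
From HB Require Import structures.
From mathcomp Require Import all_boot all_order all_algebra.
From mathcomp Require Import all_classical all_reals all_analysis.
From mathcomp Require Import complex.
From mathcomp Require Import measurable_realfun ring lra.
Import Order.TTheory GRing.Theory Num.Theory.
Import numFieldNormedType.Exports.
Local Open Scope classical_set_scope.
Local Open Scope ring_scope.

Local Notation Re := complex.Re.
Local Notation Im := complex.Im.

(** * Lipschitz bounds for cosine and sine, and distances within a set of given diameter *)

Lemma lipschitz1_of_derive {R : realType} (f df : R -> R) :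
  (forall x : R, is_derive x (1 : R) f (df x)) -> (forall x, `|df x| <= 1) ->
  forall a b, `|f a - f b| <= `|a - b|.
Proof.
move=> hf hdf a b; wlog ab : a b / b <= a.
  move=> h; have [/h//|/ltW/h] := leP b a.
  by rewrite distrC (distrC b).
have [|c _ ->] := MVT_segment ab (fun x _ => hf x).
  apply: continuous_subspaceT => x.
  by apply/differentiable_continuous/derivable1_diffP; have [] := hf x.
by rewrite normrM ler_piMl.
Qed.

Lemma cos_lipschitz1 {R : realType} (a b : R) : `|cos a - cos b| <= `|a - b|.
Proof.
apply: (lipschitz1_of_derive cos (fun x => - sin x)) => x.
by rewrite normrN ler_norml sin_geN1 sin_le1.
Qed.

Lemma sin_lipschitz1 {R : realType} (a b : R) : `|sin a - sin b| <= `|a - b|.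
Proof.
apply: (lipschitz1_of_derive sin cos) => x.
by rewrite ler_norml cos_geN1 cos_le1.
Qed.

(** Boundedness makes [sup] and [inf] genuine bounds: on a nonempty set unbounded above,
    respectively below, they default to 0 and [diam] would say nothing about distances. *)
Lemma ler_dist_diam {R : realType} (B : set R) (x y : R) :
  has_ubound B -> has_lbound B -> B x -> B y -> `|x - y| <= diam B.
Proof.
move=> uB lB Bx By.
have := ub_le_sup uB Bx; have := ub_le_sup uB By.
have := ge_inf lB Bx; have := ge_inf lB By.
by rewrite /diam ler_norml => *; apply/andP; split; lra.
Qed.

(** * Riemann sums over finite measurable partitions *)

Section tagged_partition.
Context {d} {T : measurableType d} {R : realType}
  (mu : {measure set T -> \bar R}).
Context {n : nat} (A : 'I_n -> set T) (D : set T).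
Hypothesis mA : forall j, measurable (A j).
Hypothesis disjA : forall j l, j != l -> A j `&` A l = set0.
Hypothesis coverA : \bigcup_(j in [set: 'I_n]) A j = D.

Let bigA : D = \big[setU/set0]_(j <- index_enum 'I_n) A j.
Proof.
rewrite -bigcup_seq -coverA; apply: eq_bigcupl; split => j // _.
by rewrite /= mem_index_enum.
Qed.

Let mD : measurable D.
Proof. by rewrite bigA; exact: bigsetU_measurable. Qed.

Let AD j : A j `<=` D.
Proof. by rewrite -coverA => x; exists j. Qed.

Lemma Rintegral_partition (g : T -> R) : mu.-integrable D (EFin \o g) ->
  \int[mu]_(x in D) g x = \sum_(j < n) \int[mu]_(x in A j) g x.
Proof.
move=> ig; rewrite /Rintegral.
have trivA : trivIset [set` index_enum 'I_n] A.
  apply/trivIsetP => i j _ _; exact: disjA.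
rewrite {1}bigA (integral_bigsetU_EFin mu mA (index_enum_uniq _) trivA); last first.
  by rewrite -bigA; have /integrableP[] := ig.
rewrite -sum_fine// => j _; apply: integrable_fin_num => //.
exact: integrableS ig.
Qed.

(** Each term [c j * fine (mu (A j))] is the integral of the constant [c j] over its cell, so the
    error is a sum of integrals of [c j - g] over the cells, each at most the integral of [e] there.
    The number [c j] need not be a value of [g]. *)
Lemma tagged_partition_dist (g : T -> R) (c : 'I_n -> R) (e : R) :
  (mu D < +oo)%E -> mu.-integrable D (EFin \o g) ->
  (forall j x, A j x -> `|c j - g x| <= e) ->
  `|\sum_(j < n) c j * fine (mu (A j)) - \int[mu]_(x in D) g x|
    <= e * fine (mu D).
Proof.
move=> muD ig ce.
have icstD r : mu.-integrable D (EFin \o cst r).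
  by apply: measurable_bounded_integrable => //; exact: bounded_cst.
have icst r j : mu.-integrable (A j) (EFin \o cst r) by exact: integrableS (icstD r).
have igA j : mu.-integrable (A j) (EFin \o g) by exact: integrableS ig.
rewrite -Rintegral_cst// (Rintegral_partition _ ig) (Rintegral_partition _ (icstD e)).
rewrite -sumrB; apply: le_trans (ler_norm_sum _ _ _) _.
apply: ler_sum => j _.
rewrite -Rintegral_cst// -(RintegralB (mA j) (icst (c j) j) (igA j)).
have icg : mu.-integrable (A j) (EFin \o (fun x => c j - g x)).
  exact: (integrableB (mA j) (icst (c j) j) (igA j)).
apply: le_trans (le_normr_Rintegral _ icg) _ => //.
apply: le_Rintegral => //; first exact: integrable_norm.
by move=> x; exact: ce.
Qed.

End tagged_partition.

(** * Sesquilinearity of the inner product and polarization *)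

Section L2_sesquilinear.
Context {d} {X : measurableType d} {R : realType}.
Variable nu : {measure set X -> \bar R}.
Implicit Types (f g : L2fun nu) (u v w : L2 nu).

(** Carries the facts already known for real parts of inner products over to imaginary parts, by
    scaling the first argument by -i. *)
Lemma Im_ReNi (z : R[i]) : Im z = Re (- 'i%C * z).
Proof. by rewrite Defs.ReM /=; ring. Qed.

Lemma ImMJ_integrable f g :
  nu.-integrable setT (EFin \o (fun x => Im (f x * ((g x)^*)%C))).
Proof.
apply: eq_integrable (ReMJ_integrable (- 'i%C *: f) g) => // x _.
by rewrite /= Im_ReNi mulrA.
Qed.

(** Reduces identities between inner products to pointwise identities between integrands, free of
    the chosen representatives. *)
Lemma L2_dot_class f g :
  L2_dot (L2_class f) (L2_class g) =
  cintegral nu setT (fun x => f x * ((g x)^*)%C).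
Proof.
apply/eqP; rewrite eq_complex; apply/andP; split; apply/eqP.
  exact: Re_L2_dot.
apply: ae_eq_Rintegral; [exact: ImMJ_integrable..|].
apply: filterS2 (L2_repr_class f) (L2_repr_class g) => x e1 e2 I.
by rewrite e1// e2.
Qed.

Lemma Im_L2_dot u v : Im (L2_dot u v) = Re (L2_dot (- 'i%C *: u) v).
Proof.
rewrite -(L2_classK u) -(L2_classK v) -L2_classZ !L2_dot_class.
by apply: eq_Rintegral => x _; rewrite Im_ReNi mulrA.
Qed.

Lemma L2_dotDl u v w : L2_dot (u + v) w = L2_dot u w + L2_dot v w.
Proof.
apply/eqP; rewrite eq_complex; apply/andP; split; apply/eqP.
  by rewrite Defs.ReD Re_L2_dotDl.
by rewrite Defs.ImD !Im_L2_dot scalerDr Re_L2_dotDl.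
Qed.

Lemma L2_dotC u v : L2_dot v u = ((L2_dot u v)^*)%C.
Proof.
rewrite -(L2_classK u) -(L2_classK v) !L2_dot_class.
move: (L2_repr u) (L2_repr v) => f g.
apply/eqP; rewrite eq_complex; apply/andP; split; apply/eqP.
  rewrite Re_conjc; apply: eq_Rintegral => x _.
  by rewrite !Defs.ReM !Re_conjc !Im_conjc; ring.
rewrite Im_conjc -mulN1r -RintegralZl//; last exact: ImMJ_integrable.
apply: eq_Rintegral => x _.
by rewrite !Defs.ImM !Re_conjc !Im_conjc; ring.
Qed.

Lemma L2_dotZl a u v : L2_dot (a *: u) v = a * L2_dot u v.
Proof.
rewrite -(L2_classK u) -(L2_classK v) -L2_classZ !L2_dot_class.
move: (L2_repr u) (L2_repr v) => f g.
have iRe r : nu.-integrable setT (EFin \o (fun x => r * Re (f x * ((g x)^*)%C))).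
  by apply: eq_integrable (integrableZl measurableT r (ReMJ_integrable f g)).
have iIm r : nu.-integrable setT (EFin \o (fun x => r * Im (f x * ((g x)^*)%C))).
  by apply: eq_integrable (integrableZl measurableT r (ImMJ_integrable f g)).
apply/eqP; rewrite eq_complex; apply/andP; split; apply/eqP.
  rewrite Defs.ReM /= -!RintegralZl//; do ?[exact: ReMJ_integrable|exact: ImMJ_integrable].
  rewrite -RintegralB//; apply: eq_Rintegral => x _.
  by rewrite -mulrA Defs.ReM.
rewrite Defs.ImM /= -!RintegralZl//; do ?[exact: ReMJ_integrable|exact: ImMJ_integrable].
rewrite -RintegralD//; apply: eq_Rintegral => x _.
by rewrite -mulrA Defs.ImM.
Qed.

Lemma L2_dotDr u v w : L2_dot u (v + w) = L2_dot u v + L2_dot u w.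
Proof. rewrite (L2_dotC v) (L2_dotC w) L2_dotC L2_dotDl; exact: rmorphD. Qed.

Lemma L2_dotZr a u v : L2_dot u (a *: v) = (a^*)%C * L2_dot u v.
Proof. rewrite (L2_dotC v) L2_dotC L2_dotZl; exact: rmorphM. Qed.

Lemma L2_dotNl u v : L2_dot (- u) v = - L2_dot u v.
Proof. by rewrite -scaleN1r L2_dotZl mulN1r. Qed.

Lemma L2_dot_suml (I : Type) (r : seq I) (P : pred I) (F : I -> L2 nu) v :
  L2_dot (\sum_(i <- r | P i) F i) v = \sum_(i <- r | P i) L2_dot (F i) v.
Proof.
apply: (big_morph (fun u => L2_dot u v) (fun u w => L2_dotDl u w v)).
by rewrite -(scale0r (0 : L2 nu)) L2_dotZl mul0r.
Qed.

Lemma Im_L2_dot_self u : Im (L2_dot u u) = 0.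
Proof. by have /(congr1 (@Im R)) := L2_dotC u u; rewrite Im_conjc; lra. Qed.

Lemma L2_norm_ge0 u : 0 <= L2_norm u.
Proof. exact: sqrtr_ge0. Qed.

(** Over complex scalars the quadratic form of [D] determines all values [<D x, y>]; a bound on
    these yields the norm of [D u] once [y] is [D u] itself. *)
Lemma numerical_radius_bound (D : L2 nu -> L2 nu) (e : R) : linear D -> 0 < e ->
  (forall u, `|Re (L2_dot (D u) u)| <= e * L2_norm u ^+ 2) ->
  (forall u, `|Im (L2_dot (D u) u)| <= e * L2_norm u ^+ 2) ->
  forall u, L2_norm (D u) <= 2 * e * L2_norm u.
Proof.
move=> linD e0 hRe hIm u.
have DD x y : D (x + y) = D x + D y.
  by rewrite -[x]scale1r linD !scale1r.
have D0 : D 0 = 0.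
  by have := linD (- 1) 0 0; rewrite scaler0 addr0 scaleN1r addNr.
have DZ a x : D (a *: x) = a *: D x.
  by rewrite -[a *: x]addr0 linD D0 !addr0.
have formD x y : Re (L2_dot (D x) y) <= e * (L2_norm x ^+ 2 + L2_norm y ^+ 2).
  (* Polarization: the first two bounds control the part of <D x, y> symmetric
     in x and y, the last two the antisymmetric part. *)
  have h1 := hRe (x + y); have h2 := hRe (x + (- 1) *: y).
  have h3 := hIm (x + 'i%C *: y); have h4 := hIm (x + (- 'i%C) *: y).
  move: h1 h2 h3 h4.
  rewrite !sqr_L2_norm !(DD, DZ, L2_dotDl, L2_dotDr, L2_dotZl, L2_dotZr).
  rewrite (L2_dotC x y).
  move: (L2_dot (D x) x) (L2_dot (D y) y) (L2_dot (D x) y) (L2_dot (D y) x)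
    (L2_dot x x) (L2_dot y y) (L2_dot x y).
  (* In real coordinates the four bounds are linear once products with [e] count as atoms; adding
     them cancels [<D y, x>] and the cross terms of the norms. *)
  move=> [a1 a2] [b1 b2] [c1 c2] [d1 d2] [f1 f2] [g1 g2] [h1 h2] /=.
  rewrite !ler_norml => /andP[? ?] /andP[? ?] /andP[? ?] /andP[? ?].
  lra.
rewrite -ler_sqr ?nnegrE ?mulr_ge0 ?L2_norm_ge0// ?(ltW e0)//.
(* The scaling 2 e balances the two sides: 2 e |D u|^2 <= e (4 e^2 |u|^2 + |D u|^2), so one e |D
   u|^2 is absorbed and division by e remains. *)
have := formD ((2 * e)%:C%C *: u) (D u).
rewrite !sqr_L2_norm exprMn sqr_L2_norm !(DZ, L2_dotZl, L2_dotZr) /=.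
move: (L2_dot (D u) (D u)) (L2_dot u u) => [a1 a2] [b1 b2] /=.
rewrite -(ler_pM2l e0) => ?; lra.
Qed.
End L2_sesquilinear.

(** * The Koopman operator as a linear map, and Riemann sums of spectral integrals *)

Lemma koopman_linear {d} {X : measurableType d} {R : realType}
  (nu : {measure set X -> \bar R}) (T : X -> X) (hT : invertible_mpt nu T) :
  linear (koopman hT).
Proof.
move=> a u v; rewrite -(L2_classK u) -(L2_classK v) -L2_classZ -L2_classD.
rewrite !koopmanE -L2_classZ -L2_classD.
by apply: L2_class_eq; apply: aeW.
Qed.

Section spectral_sums.
Context {d} {X : measurableType d} {R : realType}.
Variable nu : {measure set X -> \bar R}.
Variables (E : set R -> L2 nu -> L2 nu) (hE : projection_valued_measure E).

Lemma spectral_measureE u (B : set R) : unit_borel B ->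
  spectral_measure hE u B = (Re (L2_dot (E B u) u))%:E.
Proof. by move=> [mB sB]; rewrite /spectral_measure asboolT// setIidl. Qed.

Lemma spectral_measure_unit u :
  spectral_measure hE u `[0, 1] = (L2_norm u ^+ 2)%:E.
Proof.
by rewrite spectral_measureE ?(pvm_full hE) ?sqr_L2_norm//; split.
Qed.

(** The spectral measure records only a real part. Nothing is lost, since idempotence and
    self-adjointness turn [<E B u, u>] into [<E B u, E B u>], which is real. *)
Lemma pvm_dot_self u (B : set R) : unit_borel B ->
  L2_dot (E B u) u = (fine (spectral_measure hE u B))%:C%C.
Proof.
move=> uB; have pB := pvm_proj hE uB; have dotB : L2_dot (E B u) u = L2_dot (E B u) (E B u).
  by rewrite -{1}(orthproj_idem pB) (orthproj_selfadj pB).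
rewrite spectral_measureE// dotB.
apply/eqP; rewrite eq_complex; apply/andP; split; apply/eqP => //.
by rewrite Im_L2_dot_self.
Qed.

(** The real and imaginary parts of the quadratic form of the difference are Riemann sum errors for
    [Re phi] and [Im phi] against a measure of mass |u|^2. Integrability rules out the default value
    0 of an infinite real-valued integral. *)
Lemma spectral_sum_norm_le (phi : R -> R[i]) (S : L2 nu -> L2 nu) (n : nat)
    (A : 'I_n -> set R) (c : 'I_n -> R[i]) (e : R) :
  linear S -> is_spectral_integral hE phi S ->
  (forall u, (spectral_measure hE u).-integrable `[0, 1]
    (EFin \o (fun x => Re (phi x)))) ->
  (forall u, (spectral_measure hE u).-integrable `[0, 1]
    (EFin \o (fun x => Im (phi x)))) ->
  (forall j, measurable (A j)) ->
  (forall j l, j != l -> A j `&` A l = set0) ->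
  \bigcup_(j in [set: 'I_n]) A j = `[0, 1]%classic ->
  0 < e ->
  (forall j x, A j x -> `|Re (c j) - Re (phi x)| <= e) ->
  (forall j x, A j x -> `|Im (c j) - Im (phi x)| <= e) ->
  forall u, L2_norm (\sum_(j < n) c j *: E (A j) u - S u) <= 2 * e * L2_norm u.
Proof.
move=> linS intS iRe iIm mA disjA coverA e0 cRe cIm.
have uA j : unit_borel (A j).
  by split => //; rewrite -coverA => x; exists j.
pose D u := \sum_(j < n) c j *: E (A j) u - S u.
have linD : linear D.
  move=> a u v; rewrite /D linS scalerBr scaler_sumr opprD addrACA -big_split/=.
  congr (_ + _); apply: eq_bigr => j _.
  by rewrite (orthproj_linear (pvm_proj hE (uA j))) scalerDr !scalerA mulrC.
have muE u : (spectral_measure hE u `[0%R, 1%R]%classic < +oo)%E.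
  by rewrite spectral_measure_unit ltry.
have dotD u : L2_dot (D u) u = \sum_(j < n) c j * (fine (spectral_measure hE u (A j)))%:C%C
    - cintegral (spectral_measure hE u) `[0, 1] phi.
  rewrite L2_dotDl L2_dotNl intS L2_dot_suml; congr (_ - _).
  by apply: eq_bigr => j _; rewrite L2_dotZl pvm_dot_self.
have ReD u : Re (L2_dot (D u) u) =
    \sum_(j < n) Re (c j) * fine (spectral_measure hE u (A j))
    - \int[spectral_measure hE u]_(x in `[0, 1]) Re (phi x).
  rewrite dotD Defs.ReD Defs.ReN
    (big_morph _ (@Defs.ReD R) (erefl : Re 0 = 0)); congr (_ - _).
  by apply: eq_bigr => j _; rewrite Defs.ReM mulr0 subr0.
have ImD u : Im (L2_dot (D u) u) =
    \sum_(j < n) Im (c j) * fine (spectral_measure hE u (A j))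
    - \int[spectral_measure hE u]_(x in `[0, 1]) Im (phi x).
  rewrite dotD Defs.ImD Defs.ImN
    (big_morph _ (@Defs.ImD R) (erefl : Im 0 = 0)); congr (_ - _).
  by apply: eq_bigr => j _; rewrite Defs.ImM mulr0 add0r.
have normE u : L2_norm u ^+ 2 = fine (spectral_measure hE u `[0, 1]).
  by rewrite spectral_measure_unit.
apply: (@numerical_radius_bound _ _ _ nu D e) => // u; rewrite normE.
- rewrite ReD; exact: (tagged_partition_dist _ A _ mA disjA coverA _
    (fun j => Re (c j)) e (muE u) (iRe u) cRe).
- rewrite ImD; exact: (tagged_partition_dist _ A _ mA disjA coverA _
    (fun j => Im (c j)) e (muE u) (iIm u) cIm).
Qed.

End spectral_sums.

(** Meant for the cosine and sine parts of [expi2pi], whence the bound 1. *)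
Lemma continuous_bounded_integrable {R : realType} (mu : {measure set R -> \bar R})
    (D : set R) (g : R -> R) : measurable D -> (mu D < +oo)%E ->
  continuous g -> (forall x, `|g x| <= 1) -> mu.-integrable D (EFin \o g).
Proof.
move=> mD muD cg g1; apply: measurable_bounded_integrable => //.
  by apply: measurable_funTS; exact: continuous_measurable_fun.
by exists 1; split => // y y1 x _ /=; rewrite (le_trans (g1 x))// ltW.
Qed.

(** * Strong convergence of the sums to the Koopman operator *)

Theorem theorem5 (d : measure_display) (X : measurableType d) (R : realType)
  (nu : {measure set X -> \bar R})
  (T : X -> X) (hT : invertible_mpt nu T)
  (E : set R -> L2 nu -> L2 nu) (hE : projection_valued_measure E)
  (hU : is_spectral_integral hE (@expi2pi R) (koopman hT))
  (A : forall K : nat, 'I_K -> set R)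
  (hA_borel : forall (K : nat) (j : 'I_K), measurable (A K j))
  (hA_disjoint : forall (K : nat) (j l : 'I_K), j != l ->
     A K j `&` A K l = set0)
  (hA_cover : forall K : nat, (0 < K)%N ->
     \bigcup_(j in [set: 'I_K]) A K j = `[0, 1]%classic)
  (hA_diam : \big[Num.max/0]_(j < K) diam (A K j) @[K --> \oo] --> (0 : R))
  (theta : forall K : nat, 'I_K -> R)
  (htheta : forall (K : nat) (j : 'I_K), A K j (theta K j))
  (f : L2 nu) :
  L2_norm (\sum_(j < K) expi2pi (theta K j) *: E (A K j) f - koopman hT f)
    @[K --> \oo] --> (0 : R).
Proof.
apply/cvgrPdist_le => eps eps0.
have twopi0 : 0 < 2 * pi :> R by rewrite mulr_gt0// pi_gt0.
(* Chosen so that 2 e |f| = eps |f| / (|f| + 1) <= eps; the added 1 keeps the denominator positive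
   when |f| = 0. *)
pose e := eps / (2 * (L2_norm f + 1)).
have N0 := L2_norm_ge0 nu f.
have e0 : 0 < e by rewrite divr_gt0// mulr_gt0// ltr_wpDl.
move/cvgrPdist_le : hA_diam => /(_ (e / (2 * pi)) (divr_gt0 e0 twopi0)) hdiam.
near=> K.
(* The empty family at [K = 0] cannot cover [0, 1], so the covering hypothesis applies only to
   positive [K]. *)
have K0 : (0 < K)%N by near: K; exact: nbhs_infty_gt.
have maxK : \big[Num.max/0]_(j < K) diam (A K j) <= e / (2 * pi).
  apply: le_trans (ler_norm _) _; rewrite -normrN -sub0r.
  by near: K; exact: hdiam.
have dK j : 2 * pi * diam (A K j) <= e.
  rewrite mulrC -ler_pdivlMr//; apply: le_trans maxK.
  exact: (le_bigmax 0 (fun j => diam (A K j))).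
(* The factor 2 pi is absorbed into the phase, so that 1-Lipschitz bounds for cosine and sine
   suffice below. *)
have dist j x : A K j x -> `|2 * pi * theta K j - 2 * pi * x| <= e.
  move=> Ajx; rewrite -mulrBr normrM gtr0_norm//.
  apply: le_trans (dK j); rewrite ler_pM2l//.
  (* Cells inside [0, 1] are bounded, so their [diam] does control distances. *)
  have A01 : A K j `<=` `[0, 1] by rewrite -(hA_cover K K0) => y; exists j.
  apply: ler_dist_diam => //.
  - by exists 1 => y /A01; rewrite /= in_itv/= => /andP[].
  - by exists 0 => y /A01; rewrite /= in_itv/= => /andP[].
have muE u : (spectral_measure hE u `[0%R, 1%R]%classic < +oo)%E.
  by rewrite spectral_measure_unit ltry.
have twopi_continuous : continuous (fun x : R => 2 * pi * x).
  by move=> x; exact: mulrl_continuous.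
rewrite sub0r normrN ger0_norm ?L2_norm_ge0//.
apply: (@le_trans _ _ (2 * e * L2_norm f)).
  apply: (@spectral_sum_norm_le _ _ _ nu E hE (@expi2pi R)) => //.
  - exact: koopman_linear.
  - move=> u; apply: continuous_bounded_integrable => //; first exact: muE.
      move=> x; apply: continuous_comp; first exact: twopi_continuous.
      exact: continuous_cos.
    by move=> x; rewrite ler_norml cos_geN1 cos_le1.
  - move=> u; apply: continuous_bounded_integrable => //; first exact: muE.
      move=> x; apply: continuous_comp; first exact: twopi_continuous.
      exact: continuous_sin.
    by move=> x; rewrite ler_norml sin_geN1 sin_le1.
  - exact: hA_disjoint.
  - exact: hA_cover.
  - by move=> j x /dist; apply: le_trans; exact: cos_lipschitz1.
  - by move=> j x /dist; apply: le_trans; exact: sin_lipschitz1.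
rewrite /e [leLHS](_ : _ = eps * (L2_norm f / (L2_norm f + 1))); last first.
  by field; apply/lt0r_neq0; rewrite ltr_wpDl.
by rewrite ler_piMr ?(ltW eps0)// ler_pdivrMr ?ltr_wpDl// mul1r lerDl.
Unshelve. all: by end_near.
Qed.
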